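(* Let $X$ be a random variable taking values in the $\sigma$-finite measure space $(\mathcal X,\mathscr X,\mu)$, with distribution $\mu_X\ll\mu$ and $|h_\mu(X)|<\infty$. Let $(\mathcal Y,\mathscr Y)$ be a measurable space and let $\rho\colon\mathcal X\times\mathcal Y\to[0,\infty]$ be a distortion function. Let $k\in(0,\infty)$ and suppose that $\mu$ is $\rho^{1/k}$-subregular of dimension $m\in(0,\infty)$ with subregularity constants $c\in(0,\infty)$ and $\delta_0\in(0,\infty]$. Finally, assume that $\mu(\mathcal X)=1$ if $\delta_0<\infty$. Then the lower rate-distortion dimension of order $k$ satisfies $$\underline{\dim}_{\mathrm R}(X)\ge m.$$
   Context: All measures are positive, and $\sigma$-algebras contain all singletons. A distortion function $\rho\colon\mathcal X\times\mathcal Y\to[0,\infty]$ is a function measurable with respect to the product $\sigma$-algebra. $\log$ is the natural logarithm; the infimum of the empty set is $\infty$. For a distortion function $\varrho$ on $\mathcal X\times\mathcal Y$, a measure $\mu$ on $(\mathcal X,\mathscr X)$ is $\varrho$-subregular of dimension $m\in[0,\infty)$ with subregularity constants $c\in(0,\infty)$ and $\delta_0\in(0,\infty]$ if $\mu(\{x\in\mathcal X:\varrho(x,y)<\delta\})\le c\,\delta^m$ for all $y\in\mathcal Y$ and $\delta\in(0,\delta_0)$. Generalized entropy: for $\mu_X\ll\mu$ with $\mu$ $\sigma$-finite, $h_\mu(X)=-\mathbb E\left[\log\left(\frac{\mathrm d\mu_X}{\mathrm d\mu}(X)\right)\right]$. Mutual information: $I(X;Y)=\mathbb E\left[\log\frac{\mathrm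 d\mu_{(X,Y)}}{\mathrm d(\mu_X\otimes\mu_Y)}(X,Y)\right]$ if $\mu_{(X,Y)}\ll\mu_X\otimes\mu_Y$, and $I(X;Y)=\infty$ otherwise. Rate-distortion function: $$R_X(D)=\inf_{\mu_{Y|X}:\ \mathbb E[\rho(X,Y)]\le D}I(X;Y),$$ where the infimum is over all Markov kernels $\mu_{Y|X}\colon\mathscr Y\times\mathcal X\to[0,1]$ (a probability measure in the first argument, measurable in the second), $Y$ takes values in $(\mathcal Y,\mathscr Y)$ with conditional law $\mu_{Y|X}$ given $X$, and $\mathbb E[\rho(X,Y)]=\mathbb E\left[\int\rho(X,y)\,\mathrm d\mu_{Y|X}(y,X)\right]$. Lower rate-distortion dimension of order $k$: $$\underline{\dim}_{\mathrm R}(X)=\liminf_{D\to0}\frac{R_X(D^k)}{\log(1/D)}.$$ *)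

(* Defs.v *)
From HB Require Import structures.
From mathcomp Require Import all_boot all_order all_algebra.
From mathcomp Require Import all_classical all_reals all_analysis.
From mathcomp Require Import measurable_realfun.

Set Implicit Arguments.
Unset Strict Implicit.
Unset Printing Implicit Defensive.

Import Order.TTheory GRing.Theory Num.Theory.
Import numFieldNormedType.Exports.

Local Open Scope classical_set_scope.
Local Open Scope ring_scope.
Local Open Scope ereal_scope.
Local Open Scope charge_scope.

Definition is_distortion d1 d2 (X : measurableType d1) (Y : measurableType d2)
    (R : realType) (rho : X * Y -> \bar R) : Prop :=
  measurable_fun [set: X * Y] rho /\ (forall z, 0 <= rho z).

Definition subregular d1 d2 (X : measurableType d1) (Y : measurableType d2)
    (R : realType) (rho : X * Y -> \bar R) (mu : {measure set X -> \bar R})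
    (m c : R) (delta0 : \bar R) : Prop :=
  [/\ (0 <= m)%R, (0 < c)%R, 0 < delta0 &
      forall (y : Y) (delta : R), (0 < delta)%R -> delta%:E < delta0 ->
        mu [set x | rho (x, y) < delta%:E] <= (c * delta `^ m)%:E].

Section entropy.
Context d d1 (T : measurableType d) (X : measurableType d1) (R : realType).

(* If both the positive and the negative part of the integrand have infinite
   integral, [integral] is -oo and the value below is +oo; hence a finite
   [gen_entropy] means that the expectation exists and is finite. *)
Definition gen_entropy (mu : {sigma_finite_measure set X -> \bar R})
    (P : probability T R) (U : {RV P >-> X}) : \bar R :=
  - \int[P]_w
      lne (('d (charge_of_finite_measure (distribution P U)) '/d mu) (U w)).

End entropy.

Section pair_of_random_variables.
Context d d1 d2 (T : measurableType d) (X : measurableType d1)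
  (Y : measurableType d2).

Definition pair_fun (U : {mfun T >-> X}) (V : {mfun T >-> Y}) : T -> X * Y :=
  fun w => (U w, V w).

Let measurable_pair_fun U V : measurable_fun [set: T] (pair_fun U V).
Proof. exact/measurable_fun_pair. Qed.

HB.instance Definition _ U V :=
  isMeasurableFun.Build _ _ _ _ (pair_fun U V) (measurable_pair_fun U V).

HB.instance Definition _ :=
  isMeasurableFun.Build _ _ (X * Y)%type X fst measurable_fst.

HB.instance Definition _ :=
  isMeasurableFun.Build _ _ (X * Y)%type Y snd measurable_snd.

End pair_of_random_variables.

Definition mutual_information d d1 d2 (T : measurableType d)
    (X : measurableType d1) (Y : measurableType d2) (R : realType)
    (P : probability T R) (U : {RV P >-> X}) (V : {RV P >-> Y}) : \bar R :=
  let joint : probability (X * Y)%type R := distribution P (pair_fun U V) in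
  let prod : probability (X * Y)%type R :=
    distribution P U \x distribution P V in
  if `[< joint `<< prod >] then
    \int[P]_w lne (('d (charge_of_finite_measure joint) '/d prod) (U w, V w))
  else +oo.

Section joint_law.
Context d1 d2 (X : measurableType d1) (Y : measurableType d2) (R : realType).
Variables (nu : probability X R) (K : R.-pker X ~> Y).

(* law of a pair (X, Y) such that X has law nu and K is the conditional law of
   Y given X *)
Definition joint_law (A : set (X * Y)) : \bar R :=
  \int[nu]_x K x (xsection A x).

Let joint_law0 : joint_law set0 = 0.
Proof. by apply: integral0_eq => x _; rewrite xsection0 measure0. Qed.

Let joint_law_ge0 A : 0 <= joint_law A.
Proof. exact: integral_ge0. Qed.

Let joint_law_sigma_additive : semi_sigma_additive joint_law.
Proof.
move=> F mF tF mUF.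
suff -> : joint_law (\bigcup_n F n) = \sum_(n <oo) joint_law (F n).
  by apply/cvg_closeP; split; [exact: is_cvg_nneseries|rewrite closeE].
have mK n : measurable_fun [set: X] (fun x => K x (xsection (F n) x)).
  by apply: (measurable_fun_xsection_finite_kernel K); rewrite inE.
rewrite /joint_law -(integral_nneseries nu measurableT mK)//.
apply: eq_integral => x _; apply/esym/cvg_lim => //=; rewrite xsection_bigcup.
apply: (measure_sigma_additive _ (trivIset_xsection tF)) => ?.
exact: measurable_xsection.
Qed.

HB.instance Definition _ := isMeasure.Build _ _ _ joint_law
  joint_law0 joint_law_ge0 joint_law_sigma_additive.

Let joint_lawT : joint_law [set: X * Y] = 1.
Proof.
rewrite /joint_law -[RHS](probability_setT nu) -[RHS]mul1e -integral_cst//.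
by apply: eq_integral => x _; rewrite xsectionE preimage_setT prob_kernel.
Qed.

HB.instance Definition _ :=
  Measure_isProbability.Build _ _ _ joint_law joint_lawT.

End joint_law.

Definition rate_distortion d d1 d2 (T : measurableType d)
    (X : measurableType d1) (Y : measurableType d2) (R : realType)
    (P : probability T R) (U : {RV P >-> X}) (rho : X * Y -> \bar R) (D : R) :
    \bar R :=
  ereal_inf
    [set mutual_information (P := joint_law (distribution P U) K) fst snd |
      K in [set K : R.-pker X ~> Y |
             \int[P]_w \int[K (U w)]_y rho (U w, y) <= D%:E]].

Definition lower_rd_dim d d1 d2 (T : measurableType d)
    (X : measurableType d1) (Y : measurableType d2) (R : realType)
    (P : probability T R) (U : {RV P >-> X}) (rho : X * Y -> \bar R) (k : R) :
    \bar R :=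
  limf_einf (fun D : R => rate_distortion U rho (D `^ k) / (ln D^-1)%:E)
    (0%R : R)^'+.

(* Main.v *)
Require Import Defs.
From HB Require Import structures.
From mathcomp Require Import all_boot all_order all_algebra.
From mathcomp Require Import all_classical all_reals all_analysis.
From mathcomp Require Import measurable_realfun.
From mathcomp Require Import ring lra.

Set Implicit Arguments.
Unset Strict Implicit.
Unset Printing Implicit Defensive.

Import Order.TTheory GRing.Theory Num.Theory.
Import numFieldNormedType.Exports.

Local Open Scope classical_set_scope.
Local Open Scope ring_scope.
Local Open Scope ereal_scope.

(** The proof is the Shannon lower bound, for the one-parameter family of
    exponential tilts of the distortion.  Write f for the density of the law of
    X with respect to mu, J for the joint law of (X, Y) under an admissible
    channel and i for the density of J with respect to the product Q of its
    marginals, so that I(X;Y) = E_J[log i].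

    Jensen's inequality in the form 1 + z <= exp z gives
    I(X;Y) >= E_J[eta] - log g as soon as the Q-integral of exp eta is at most
    g: integrating 1/i against J costs at most Q ([mutual_information_ge]).
    Take eta(x,y) = - log f(x) - s rho(x,y).  The factor 1/f turns the law of X
    back into mu, so g can be any uniform bound in y for the mu-integral of
    exp(- s rho(x,y)), and
      I(X;Y) >= h_mu(X) - s E[rho(X,Y)] - log g   ([shannon_lower_bound]).

    Subregularity enters only through g.  When delta0 is finite, mu is a
    probability measure and enlarging c extends the bound on
    mu{rho(.,y)^(1/k) < delta} to all delta > 0 ([subregular_preimage_le]).
    Slicing the space according to the integer part of s rho(.,y) then yields
    g = C s^(-m/k) ([integral_exp_le]).  With s of order D^(-k), the constraint
    E[rho] <= D^k makes s E[rho] bounded and log g = log C - m log(1/D), whence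
    R_X(D^k) >= m log(1/D) + a for a constant a.  Dividing by log(1/D) and
    letting D tend to 0 concludes. *)

(** * Extended logarithm and exponential *)

Lemma measurable_lne (R : realType) : measurable_fun [set: \bar R] (@lne R).
Proof.
rewrite (_ : @lne R = fun x => if x == +oo then +oo else
    if x <= 0 then -oo else (ln (fine x))%:E); last first.
  by apply/funext => -[r| |] //=; rewrite leNye.
apply: measurable_fun_ifT => //=; first exact: measurable_fun_eqe.
apply: measurable_fun_ifT => //=; first exact: measurable_fun_lee.
exact/measurable_EFinP/measurableT_comp.
Qed.

Lemma measurable_expeR (R : realType) :
  measurable_fun [set: \bar R] (@expeR R).
Proof.
rewrite (_ : @expeR R = fun x => if x == +oo then +oo else
    if x == -oo then 0 else (expR (fine x))%:E); last first.
  by apply/funext => -[r| |].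
apply: measurable_fun_ifT => //=; first exact: measurable_fun_eqe.
apply: measurable_fun_ifT => //=; first exact: measurable_fun_eqe.
exact/measurable_EFinP/measurableT_comp.
Qed.

(** * Integration against the joint law of a source and a channel *)

Section graph_kernel.
Context d1 d2 (X : measurableType d1) (Y : measurableType d2) (R : realType).
Variable K : R.-pker X ~> Y.

(** The law of (x, Y) when Y has law K x.  Composing it with the law of the
    source gives the joint law; the dummy factor [unit] is there because kernel
    composition lets the second kernel depend on the input of the first. *)
Definition graph_kernel (u : unit * X) : {measure set (X * Y) -> \bar R} :=
  measure_function_pushforward__canonical__measure_function_Measure
    (K u.2) (pair1_measurable u.2).

Let measurable_graph_kernel A : measurable A ->
  measurable_fun [set: unit * X] (graph_kernel ^~ A).
Proof.
move=> mA; rewrite (_ : graph_kernel ^~ A = (fun x => K x (xsection A x)) \o snd).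
  apply: measurableT_comp => //.
  by apply: measurable_fun_xsection_finite_kernel; rewrite inE.
by apply/funext => -[u x] /=; rewrite /graph_kernel/pushforward/= xsectionE.
Qed.

HB.instance Definition _ :=
  isKernel.Build _ _ _ _ R graph_kernel measurable_graph_kernel.

Let graph_kernelT u : graph_kernel u [set: X * Y] = 1.
Proof. by rewrite /graph_kernel/= /pushforward preimage_setT prob_kernel. Qed.

HB.instance Definition _ :=
  Kernel_isProbability.Build _ _ _ _ R graph_kernel graph_kernelT.

End graph_kernel.

Lemma ge0_integral_joint_law d1 d2 (X : measurableType d1)
    (Y : measurableType d2) (R : realType) (nu : probability X R)
    (K : R.-pker X ~> Y) (f : X * Y -> \bar R) :
    (forall z, 0 <= f z) -> measurable_fun [set: X * Y] f ->
  \int[joint_law nu K]_z f z = \int[nu]_x \int[K x]_y f (x, y).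
Proof.
move=> f0 mf.
pose l : R.-pker unit ~> X :=
  kprobability (measurable_cst (nu : pprobability X R)).
rewrite (eq_measure_integral (kcomp l (graph_kernel K) tt)); last first.
  move=> A _ _; rewrite /= /kcomp /joint_law; apply: eq_integral => x _.
  by rewrite /graph_kernel /= /pushforward xsectionE.
rewrite integral_kcomp//; apply: eq_integral => x _.
rewrite [LHS]ge0_integral_pushforward//.
Qed.

(** * Change of measure by the inverse density *)

(** This is t^-1 * t <= 1, with t^-1 written so that it makes sense for every
    extended real, including the negative values that a Radon-Nikodym derivative
    may take on a null set. *)
Lemma expeR_opp_lne_mul_le1 (R : realType) (t : \bar R) : expeR (- lne t) * t <= 1.
Proof.
case: t => [r| |] /=.
- case: ifPn => [r0|]; last first.
    rewrite -ltNge => r0 /=; rewrite expRN lnK// -EFinM mulVf//.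
    by rewrite gt_eqF.
  rewrite /=; have [r1|] := ltP r 0%R.
    by rewrite mulyr ltr0_sg// mulN1e leNye.
  by move=> r1; rewrite (_ : r = 0%R) ?mule0 ?lee01//; apply/eqP; rewrite eq_le r0.
- by rewrite mul0e.
- by rewrite mulyNy leNye.
Qed.

(** Equality may fail because nu does not see the set where its density
    vanishes, while mu does. *)
Lemma le_integral_inv_density d (T : measurableType d) (R : realType)
    (nu : {finite_measure set T -> \bar R})
    (mu : {sigma_finite_measure set T -> \bar R}) (phi : T -> \bar R) :
    nu `<< mu -> (forall x, 0 <= phi x) -> measurable_fun [set: T] phi ->
  \int[nu]_x (expeR (- lne (Radon_Nikodym (charge_of_finite_measure nu) mu x)) * phi x)
    <= \int[mu]_x phi x.
Proof.
move=> numu phi0 mphi.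
pose F x := expeR (- lne (Radon_Nikodym (charge_of_finite_measure nu) mu x))
  * phi x.
rewrite -[leLHS]/(\int[nu]_x F x).
have F0 x : 0 <= F x by rewrite mule_ge0// expeR_ge0.
have mF : measurable_fun [set: T] F.
  apply: emeasurable_funM => //.
  apply: (measurableT_comp (@measurable_expeR R)).
  apply: measurableT_comp => //.
  by apply: (measurableT_comp (@measurable_lne R)).
rewrite -(Radon_Nikodym_SigmaFinite.change_of_variables numu)//.
apply: ae_ge0_le_integral => //.
- by move=> x _; apply: mule_ge0 => //; exact: Radon_Nikodym_SigmaFinite.f_ge0.
- apply: emeasurable_funM => //.
  exact: measurable_int (Radon_Nikodym_SigmaFinite.f_integrable _).
apply: filterS (ae_eq_Radon_Nikodym_SigmaFinite numu measurableT) => x /= H xT.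
rewrite H// /F muleAC -[leRHS]mul1e.
exact/lee_wpmul2r/expeR_opp_lne_mul_le1.
Qed.

(** * The variational inequality *)

Lemma ae_ge0_integral d (T : measurableType d) (R : realType)
    (mu : {measure set T -> \bar R}) (h : T -> \bar R) :
    measurable_fun [set: T] h -> {ae mu, forall x, 0 <= h x} ->
  0 <= \int[mu]_x h x.
Proof.
move=> mh h0; rewrite (_ : \int[mu]_x h x = \int[mu]_x `|h x|).
  exact: integral_ge0.
apply: ae_eq_integral => //; first exact: measurableT_comp.
by apply: filterS h0 => x hx _ /=; rewrite gee0_abs.
Qed.

Lemma integral_posneg_lty_integrable d (T : measurableType d) (R : realType)
    (mu : {measure set T -> \bar R}) (f : T -> \bar R) :
    measurable_fun [set: T] f ->
    \int[mu]_x f^\+ x < +oo -> \int[mu]_x f^\- x < +oo ->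
  mu.-integrable [set: T] f.
Proof.
move=> mf fpos fneg; apply/integrableP; split => //.
under eq_integral do rewrite -[`|_|]/((abse \o f) _) fune_abse.
rewrite ge0_integralD//; last 2 first.
- exact: measurable_funepos.
- exact: measurable_funeneg.
exact: lte_add_pinfty.
Qed.

(** This is 1 + z <= exp z at z = e - l - ln g. *)
Lemma gibbs_pointwise (R : realType) (g l e : R) : (0 < g)%R ->
  (1 - ln g <= l - e + g^-1 * (expR (- l) * expR e))%R.
Proof.
move=> g0; have := expR_ge1Dx (e - l - ln g)%R.
have -> : expR (e - l - ln g) = (g^-1 * (expR (- l) * expR e))%R.
  by rewrite expRD (expRN (ln g)) lnK ?posrE// expRD mulrC [in LHS](mulrC (expR e)).
lra.
Qed.

Lemma maxe_opp0_le_expeR (R : realType) (x : \bar R) : maxe (- x) 0 <= expeR (- x).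
Proof.
rewrite ge_max expeR_ge0 andbT.
case: x => [r| |] //=.
by rewrite lee_fin; apply: le_trans (expR_ge1Dx _); rewrite lerDr.
Qed.

(** Integrate [gibbs_pointwise] at l = L x and e = eta x: the exponential term
    contributes at most g^-1 * g = 1.  The finiteness of the integral of exp(- L)
    makes the negative part of L integrable, so that the integral of L is either
    +oo, and the claim is trivial, or finite, and then all terms can be integrated
    separately. *)
Lemma gibbs_variational d (T : measurableType d) (R : realType) (P : probability T R)
    (L eta : T -> \bar R) (g : R) :
    measurable_fun [set: T] L -> P.-integrable [set: T] eta -> (0 < g)%R ->
    \int[P]_x expeR (- L x) < +oo ->
    \int[P]_x (expeR (- L x) * expeR (eta x)) <= g%:E ->
  \int[P]_x eta x - (ln g)%:E <= \int[P]_x L x.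
Proof.
move=> mL ieta g0 L1 Lg.
have meta := measurable_int _ ieta.
have mEN : measurable_fun [set: T] (fun x => expeR (- L x)).
  apply: (measurableT_comp (@measurable_expeR R)).
  exact: measurableT_comp.
have mE : measurable_fun [set: T] (fun x => expeR (- L x) * expeR (eta x)).
  apply: emeasurable_funM => //.
  exact: (measurableT_comp (@measurable_expeR R)).
have E0 x : 0 <= expeR (- L x) * expeR (eta x).
  by rewrite mule_ge0// expeR_ge0.
have Lneg : \int[P]_x L^\- x < +oo.
  apply: le_lt_trans L1; apply: ge0_le_integral => //.
  - exact: measurable_funeneg.
  - by move=> x _; rewrite funenegE maxe_opp0_le_expeR.
have Lneg_fin : \int[P]_x L^\- x \is a fin_num.
  by rewrite ge0_fin_numE// integral_ge0.
have [Lpos|] := ltP (\int[P]_x L^\+ x) +oo; last first.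
  have /fin_numP[Ny _] : - (\int[P]_x L^\- x) \is a fin_num by rewrite fin_numN.
  by rewrite leye_eq [leRHS]integralE => /eqP ->; rewrite addye ?leey.
have iL : P.-integrable [set: T] L.
  exact: integral_posneg_lty_integrable.
have iE : P.-integrable [set: T] (fun x => expeR (- L x) * expeR (eta x)).
  apply/integrableP; split => //.
  under eq_integral do rewrite gee0_abs//.
  by rewrite (le_lt_trans Lg)// ltry.
have igE := integrableZl measurableT g^-1 iE.
have iLe := integrableB measurableT iL ieta.
have ic : P.-integrable [set: T] (cst (1 - ln g)%:E).
  exact: finite_measure_integrable_cst.
have iLeE := integrableD measurableT iLe igE.
have : 0 <= \int[P]_x (L x - eta x
    + (g^-1)%:E * (expeR (- L x) * expeR (eta x)) - (1 - ln g)%:E).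
  apply: ae_ge0_integral.
    exact: measurable_int (integrableB measurableT iLeE ic).
  have := integrable_ae measurableT ieta.
  apply: filterS2 (integrable_ae measurableT iL) => x /(_ I) + /(_ I).
  case: (L x) => [l| |]// _; case: (eta x) => [e| |]// _.
  by rewrite /= -!EFinM -!EFinB lee_fin subr_ge0 gibbs_pointwise.
rewrite (integralB measurableT iLeE ic) (integralD measurableT iLe igE).
rewrite (integralB measurableT iL ieta) integral_cst// [in X in _ * X]/= probability_setT mule1.
rewrite ge0_integralZl//; last by rewrite lee_fin invr_ge0 ltW.
have Lfin := integrable_fin_num measurableT iL.
have efin := integrable_fin_num measurableT ieta.
have Efin := integrable_fin_num measurableT iE.
move: Lg.
rewrite -(fineK Lfin) -(fineK efin) -(fineK Efin).
rewrite -!EFinM -!EFinB !lee_fin => Lg.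
have : (g^-1 * fine (\int[P]_x (expeR (- L x) * expeR (eta x))) <= 1)%R.
  by rewrite -(mulVf (lt0r_neq0 g0)) ler_wpM2l// invr_ge0 ltW.
lra.
Qed.

(** * The Shannon lower bound *)

(** The Donsker-Varadhan lower bound: [gibbs_variational] with L the information
    density i of the pair.  Both integrals of exp(- L) = 1/i that it asks for are
    integrals against the joint law, and become integrals against the product law
    by [le_integral_inv_density]. *)
Lemma mutual_information_ge d d1 d2 (T : measurableType d)
    (X : measurableType d1) (Y : measurableType d2) (R : realType)
    (P : probability T R) (U : {RV P >-> X}) (V : {RV P >-> Y})
    (eta : X * Y -> \bar R) (g : R) :
    measurable_fun [set: X * Y] eta ->
    P.-integrable [set: T] (fun w => eta (U w, V w)) -> (0 < g)%R ->
    \int[(distribution P U \x distribution P V)%E]_z expeR (eta z) <= g%:E ->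
  \int[P]_w eta (U w, V w) - (ln g)%:E <= mutual_information U V.
Proof.
move=> meta ieta g0 etag; rewrite /mutual_information.
set J : probability (X * Y)%type R := distribution P (pair_fun U V).
set Q : probability (X * Y)%type R := distribution P U \x distribution P V.
case: ifPn => [/asboolP JQ|_]; last exact: leey.
have mexp (h : X * Y -> \bar R) : measurable_fun [set: X * Y] h ->
    measurable_fun [set: X * Y] (fun z => expeR (h z)).
  exact: (measurableT_comp (@measurable_expeR R)).
pose L z := lne (Radon_Nikodym (charge_of_finite_measure J) Q z).
have mL : measurable_fun [set: X * Y] L.
  by apply: (measurableT_comp (@measurable_lne R)).
have mEL : measurable_fun [set: X * Y] (fun z => expeR (- L z)).
  by apply: mexp; exact: measurableT_comp.
have mpair : measurable_fun [set: T] (fun w => (U w, V w)).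
  exact/measurable_fun_pair.
have push (h : X * Y -> \bar R) : measurable_fun [set: X * Y] h ->
    (forall z, 0 <= h z) -> \int[P]_w h (U w, V w) = \int[J]_z h z.
  by move=> mh h0; rewrite [RHS]ge0_integral_pushforward.
apply: (@gibbs_variational _ _ _ _ (fun w => L (U w, V w))) => //.
- exact: (measurableT_comp mL).
- rewrite (push (fun z => expeR (- L z)))//; last by move=> z; exact: expeR_ge0.
  apply: (@le_lt_trans _ _ (\int[Q]_z cst 1 z)).
    under eq_integral do rewrite -[expeR _]mule1.
    exact: le_integral_inv_density.
  rewrite integral_cst// mul1e.
  exact: le_lt_trans (probability_le1 Q measurableT) (ltry _).
- rewrite (push (fun z => expeR (- L z) * expeR (eta z)))//.
  + apply: le_trans etag; apply: le_integral_inv_density => //.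
    * by move=> z; exact: expeR_ge0.
    * exact: mexp.
  + by apply: emeasurable_funM => //; exact: mexp.
  + by move=> z; rewrite mule_ge0// expeR_ge0.
Qed.

Section Shannon_lower_bound.
Context d d1 d2 (T : measurableType d) (X : measurableType d1)
  (Y : measurableType d2) (R : realType).
Variables (P : probability T R) (U : {RV P >-> X})
  (mu : {sigma_finite_measure set X -> \bar R}).
Hypotheses (U_mu : distribution P U `<< mu)
  (entropy_fin : `|gen_entropy mu U| < +oo).

Definition log_density x :=
  lne (Radon_Nikodym (charge_of_finite_measure (distribution P U)) mu x).

Lemma measurable_log_density : measurable_fun [set: X] log_density.
Proof. by apply: (measurableT_comp (@measurable_lne R)). Qed.

(** A finite entropy is a difference of two integrals of nonnegative functions;
    both are finite because extended subtraction returns an infinite value as soon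
    as one of them is infinite. *)
Lemma integrable_log_density : P.-integrable [set: T] (fun w => log_density (U w)).
Proof.
have mlU : measurable_fun [set: T] (fun w => log_density (U w)).
  exact: (measurableT_comp measurable_log_density).
have : \int[P]_w log_density (U w) \is a fin_num.
  by move: entropy_fin; rewrite /gen_entropy abseN -fin_num_abs.
rewrite integralE fin_numB => /andP[posfin negfin].
by apply: integral_posneg_lty_integrable => //;
  rewrite -ge0_fin_numE// integral_ge0.
Qed.

Lemma joint_law_fst (K : R.-pker X ~> Y) (A : set X) : measurable A ->
  distribution (joint_law (distribution P U) K) fst A = distribution P U A.
Proof.
move=> mA; transitivity (\int[distribution P U]_x (\1_A x)%:E); last first.
  by rewrite integral_indic// setIT.
rewrite /distribution /= /pushforward /= /joint_law; apply: eq_integral => x _.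
rewrite indicE; have [xA|xA] := boolP (x \in A).
  rewrite (_ : xsection _ x = setT) ?prob_kernel//.
  by apply/seteqP; split => // y _; rewrite xsectionE; apply/set_mem.
rewrite (_ : xsection _ x = set0) ?measure0//.
apply/seteqP; split => // y; rewrite xsectionE /= => Ax.
by move/negP: xA; apply; rewrite inE.
Qed.

Lemma integral_log_density_joint_law (K : R.-pker X ~> Y) :
  let J := joint_law (distribution P U) K in
  J.-integrable [set: X * Y] (fun z => log_density z.1) /\
  \int[J]_z log_density z.1 = - gen_entropy mu U.
Proof.
move=> J; have mld := measurable_log_density.
have eqJ (h : X -> \bar R) :
    \int[distribution J fst]_x h x = \int[distribution P U]_x h x.
  by apply: eq_measure_integral => A mA _; exact: joint_law_fst.
have iJ : J.-integrable [set: X * Y] (fun z => log_density z.1).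
  apply/integrableP; split; first exact: (measurableT_comp measurable_log_density).
  have mabs : measurable_fun [set: X] (fun x => `|log_density x|).
    exact: measurableT_comp.
  have := eqJ (fun x => `|log_density x|).
  rewrite ge0_integral_pushforward// [RHS]ge0_integral_pushforward//.
  rewrite !preimage_setT => ->.
  by case/integrableP: integrable_log_density.
split => //.
have := eqJ log_density.
rewrite integral_pushforward// [RHS]integral_pushforward//; last first.
  exact: integrable_log_density.
by rewrite !preimage_setT /gen_entropy oppeK => ->.
Qed.

(** [mutual_information_ge] with eta(x,y) = - log f(x) - s rho(x,y), f the density
    of the source.  By Tonelli the product integral of exp eta is an average over y
    of integrals of exp(- s rho(x,y)) / f(x) against the law of the source, and
    these are at most the integrals of exp(- s rho(x,y)) against mu. *)
Lemma shannon_lower_bound (rho : X * Y -> \bar R) (s g : R) (Delta : R)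
    (K : R.-pker X ~> Y) :
    is_distortion rho -> (0 <= s)%R -> (0 < g)%R ->
    (forall y, \int[mu]_x expeR (- (s%:E * rho (x, y))) <= g%:E) ->
    \int[P]_w \int[K (U w)]_y rho (U w, y) <= Delta%:E ->
  gen_entropy mu U - (s * Delta)%:E - (ln g)%:E <=
  mutual_information (P := joint_law (distribution P U) K) fst snd.
Proof.
move=> [mrho rho0] s0 g0 hg hD; have mld := measurable_log_density.
set J := joint_law (distribution P U) K.
have [il hl] := integral_log_density_joint_law K.
have Jrho : \int[J]_z rho z <= Delta%:E.
  rewrite ge0_integral_joint_law// ge0_integral_pushforward//.
    exact: (measurable_fun_integral_finite_kernel rho K).
  by move=> x _; exact: integral_ge0.
have irho : J.-integrable [set: X * Y] rho.
  apply/integrableP; split => //; under eq_integral do rewrite gee0_abs//.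
  exact: le_lt_trans Jrho (ltry _).
have isrho := integrableZl measurableT s irho.
pose eta z := - log_density z.1 - s%:E * rho z.
have ieta : J.-integrable [set: X * Y] eta.
  exact: integrableB (integrableN il) isrho.
have intl : \int[J]_z (- log_density z.1) = gen_entropy mu U.
  rewrite integralN; first by rewrite hl oppeK.
  exact: integrable_add_def.
have Jeta : gen_entropy mu U - (s * Delta)%:E <= \int[J]_z eta z.
  rewrite integralB//; last exact: integrableN.
  rewrite intl leeB// ge0_integralZl// EFinM.
  by rewrite lee_wpmul2l// lee_fin.
apply: (le_trans (leeB Jeta (lexx _))).
have meta := measurable_int _ ieta.
have -> : \int[J]_z eta z = \int[J]_z eta (z.1, z.2).
  by apply: eq_integral => z _; rewrite -surjective_pairing.
apply: mutual_information_ge => //.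
  by under eq_fun do rewrite -surjective_pairing.
have mEeta : measurable_fun [set: X * Y] (fun z => expeR (eta z)).
  exact: (measurableT_comp (@measurable_expeR R)).
have Eeta0 z : 0 <= expeR (eta z) by exact: expeR_ge0.
rewrite fubini_tonelli2//=.
apply: (@le_trans _ _ (\int[distribution J snd]_y (cst g%:E y))); last first.
  by rewrite integral_cst// [in X in _ * X]/= probability_setT mule1.
apply: ge0_le_integral => //.
- by move=> y _; exact: integral_ge0.
- exact: measurable_fun_fubini_tonelli_G.
move=> y _; rewrite /fubini_G.
rewrite (eq_measure_integral (distribution P U)); last first.
  by move=> A mA _; exact: joint_law_fst.
apply: le_trans (hg y).
under eq_integral do rewrite expeRD.
apply: le_integral_inv_density => //.
  by move=> x; exact: expeR_ge0.
apply: (measurableT_comp (@measurable_expeR R)).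
apply: measurableT_comp => //; apply: measurable_funeM.
exact: measurableT_comp.
Qed.
End Shannon_lower_bound.

(** * Exponential integrals of a subregular distortion *)

(** u^p exp(-u) is maximal at u = p, where it is smaller than p^p; the proof is
    ln v <= v - 1 at v = u / p. *)
Lemma powR_le_expR (R : realType) (p u : R) : (0 < p)%R -> (0 < u)%R ->
  (u `^ p <= p `^ p * expR u)%R.
Proof.
move=> p0 u0; rewrite /powR !gt_eqF// -expRD ler_expR.
have up0 : (0 < u / p)%R by rewrite divr_gt0.
have : (ln (u / p) <= u / p - 1)%R.
  have := @le_ln1Dx R (u / p - 1); rewrite addrCA subrr addr0; apply.
  by rewrite ltrBrDr addNr.
rewrite ln_div// -(ler_pM2l p0) mulrBr mulrBr mulr1 mulrCA divff ?gt_eqF//.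
lra.
Qed.

(** For finite a, the term of the series whose index is the integer part of a
    already dominates the left-hand side. *)
Lemma exp_le_eseries (R : realType) (a : \bar R) : 0 <= a ->
  expeR (- (2%:E * a)) <=
  \sum_(n <oo) (expR (- (2 * n%:R)))%:E * (a < n.+1%:R%:E)%E%:R%:E.
Proof.
have t0 n : 0 <= (expR (- (2 * n%:R)))%:E * (a < n.+1%:R%:E)%E%:R%:E :> \bar R.
  by rewrite mule_ge0// lee_fin expR_ge0.
case: a t0 => [r| |] t0 // r0; last first.
  by rewrite mulry gtr0_sg// mul1e /= nneseries_ge0.
have /andP[nr rn] := truncn_itv r0.
set n := Num.truncn r in nr rn.
apply: le_trans (@nneseries_lim_ge R _ xpredT 0 n.+1 _) => //.
rewrite big_nat_recr//= [X in _ * X](_ : _ = 1); last by rewrite lte_fin rn.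
rewrite mule1 -[leLHS]add0e leeD//.
  exact: sume_ge0.
by rewrite lee_fin ler_expR lerN2 ler_pM2l.
Qed.

(** A discrete substitute for integrating exp(-2u) against the distribution
    function of s f.  The n-th slice contributes at most
    exp(-2n) b ((n+1)/s)^p; by [powR_le_expR] one factor exp(-n) absorbs (n+1)^p
    up to a constant, and the other one, at most 2^-n, makes the series
    geometric. *)
Lemma integral_exp_le d (T : measurableType d) (R : realType)
    (mu : {measure set T -> \bar R}) (f : T -> \bar R) (b p s : R) :
    measurable_fun [set: T] f -> (forall x, 0 <= f x) ->
    (0 < b)%R -> (0 < p)%R -> (0 < s)%R ->
    (forall t : R, (0 < t)%R ->
      mu [set x | f x < t%:E] <= (b * t `^ p)%:E) ->
  \int[mu]_x expeR (- ((2 * s)%:E * f x)) <=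
  (b * (2 * expR 1 * p `^ p) * s^-1 `^ p)%:E.
Proof.
move=> mf f0 b0 p0 s0 hmu.
set C := (b * _ * _)%R.
have C0 : (0 <= C)%R.
  by rewrite !mulr_ge0// ?powR_ge0// ?expR_ge0// ltW.
pose A n := [set x | f x < (n.+1%:R / s)%:E].
have mA n : measurable (A n).
  by rewrite -[A n]setTI; exact: emeasurable_fun_infty_o.
pose F n x := (expR (- (2 * n%:R) : R))%:E * (\1_(A n) x)%:E.
have F0 n x : 0 <= F n x by rewrite mule_ge0// lee_fin expR_ge0.
have mF n : measurable_fun [set: T] (F n).
  by apply: measurable_funeM; exact/measurable_EFinP.
apply: (@le_trans _ _ (\int[mu]_x \sum_(n <oo) F n x)).
  apply: ge0_le_integral => //.
  - by move=> x _; exact: expeR_ge0.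
  - apply: (measurableT_comp (@measurable_expeR R)).
    by apply: measurableT_comp => //; exact: measurable_funeM.
  - exact: ge0_emeasurable_sum.
  - move=> x _; rewrite EFinM -muleA.
    apply: (le_trans (exp_le_eseries _)).
      by rewrite mule_ge0// lee_fin ltW.
    apply: lee_nneseries => [n _ _|n _].
      by rewrite mule_ge0// lee_fin expR_ge0.
    rewrite /F lee_wpmul2l ?lee_fin ?expR_ge0// indicE ler_nat.
    suff -> : (s%:E * f x < n.+1%:R%:E) = (x \in A n) by [].
    by apply/idP/idP => [|/set_mem]; rewrite ?inE /A/= EFinM lte_pdivlMr// muleC.
rewrite integral_nneseries//.
apply: le_trans (epsilon_trick0 xpredT C0).
apply: lee_nneseries => [n _ _|n _]; first exact: integral_ge0.
rewrite ge0_integralZl//; last exact/measurable_EFinP.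
rewrite integral_indic// setIT.
have sn0 : (0 < n.+1%:R / s)%R by rewrite divr_gt0.
apply: (@le_trans _ _ ((expR (- (2 * n%:R)))%:E * (b * (n.+1%:R / s) `^ p)%:E)).
  by rewrite lee_wpmul2l ?lee_fin ?expR_ge0//; exact: hmu.
rewrite -EFinM lee_fin powRM ?invr_ge0 ?(ltW s0)//.
have := @powR_le_expR R p n.+1%:R p0 (ltr0Sn _ _).
rewrite /C; move: (powR_ge0 s^-1 p) (powR_ge0 p p) => Spos Ppos hn.
set S := (s^-1 `^ p)%R in Spos *; set Pp := (p `^ p)%R in Ppos hn *.
have e2 : (2 ^+ n <= expR n%:R :> R)%R.
  rewrite -[n%:R]mulr1 expRM_natl lerXn2r ?nnegrE ?expR_ge0//.
  by have := @expR_ge1Dx R 1.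
rewrite ler_pdivlMr ?ltr0n ?expn_gt0// natrX exprS.
have e0 : (0 < expR n%:R :> R)%R by exact: expR_gt0.
have e1 : (expR (- (2 * n%:R)) * expR n.+1%:R * expR n%:R = expR 1 :> R)%R.
  by rewrite -!expRD; congr expR; rewrite -natr1; ring.
apply: (@le_trans _ _
    (expR (- (2 * n%:R)) * (b * (Pp * expR n.+1%:R * S)) * (2 * expR n%:R))%R).
  apply: ler_pM.
  - by rewrite !mulr_ge0 ?expR_ge0 ?powR_ge0 ?(ltW b0).
  - by rewrite mulr_ge0// exprn_ge0.
  - by rewrite ler_wpM2l ?expR_ge0// ler_wpM2l ?(ltW b0)// ler_wpM2r.
  - by rewrite ler_wpM2l.
rewrite -e1 le_eqVlt; apply/orP; left; apply/eqP; ring.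
Qed.

(** For delta >= delta0 the total mass 1 of mu is at most (delta / delta0)^m, so
    adding delta0^-m to c removes the restriction on delta.  For delta0 = +oo this
    extra term is 0, because [fine] sends +oo to 0 and 0^-1 = 0. *)
Lemma subregular_preimage_le d1 d2 (X : measurableType d1)
    (Y : measurableType d2) (R : realType) (rho : X * Y -> \bar R)
    (mu : {measure set X -> \bar R}) (k m c : R) (delta0 : \bar R) :
    is_distortion rho -> (0 < k)%R ->
    subregular (fun z => poweR (rho z) k^-1) mu m c delta0 ->
    (delta0 < +oo -> mu [set: X] = 1) ->
  exists2 b : R, (0 < b)%R & forall y (t : R), (0 < t)%R ->
    mu [set x | rho (x, y) < t%:E] <= (b * t `^ (m / k))%:E.
Proof.
move=> [mrho rho0] k0 [m0 c0 delta0_gt0 hsub] mu1.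
exists (c + (fine delta0 `^ m)^-1)%R.
  by rewrite ltr_wpDr// invr_ge0 powR_ge0.
move=> y t t0; pose delta := (t `^ k^-1)%R.
have delta_gt0 : (0 < delta)%R by exact: powR_gt0.
have deltam : (t `^ (m / k) = delta `^ m)%R by rewrite /delta -powRrM mulrC.
have mrhoy : measurable_fun [set: X] (fun x => rho (x, y)).
  exact: measurableT_comp.
have mset : measurable [set x | rho (x, y) < t%:E].
  by rewrite -[X in measurable X]setTI; exact: emeasurable_fun_infty_o.
rewrite deltam mulrDl.
have [ltd|led] := ltP delta%:E delta0.
  apply: (@le_trans _ _ (c * delta `^ m)%:E); last first.
    by rewrite lee_fin lerDl mulr_ge0// ?invr_ge0 powR_ge0.
  apply: le_trans (hsub y delta delta_gt0 ltd).
  apply: le_measure; rewrite ?inE//.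
    rewrite -[X in measurable X]setTI; apply: emeasurable_fun_infty_o => //.
    exact: (measurableT_comp (measurable_poweR _)).
  move=> x /=; case: (rho (x, y)) (rho0 (x, y)) => [r| |]//.
  rewrite lee_fin !lte_fin => r0 rt.
  by apply: gt0_ltr_powR; rewrite ?invr_gt0// nnegrE// ltW.
have delta0_lty : delta0 < +oo by apply: le_lt_trans led _; rewrite ltry.
apply: (@le_trans _ _ (mu [set: X])); first by rewrite le_measure ?inE.
rewrite mu1//.
case: delta0 delta0_gt0 delta0_lty led {hsub mu1} => [r| |]//= r0 _ led.
rewrite !lte_fin !lee_fin in r0 led *.
apply: ler_wpDl; first by rewrite mulr_ge0 ?powR_ge0// ltW.
rewrite mulrC ler_pdivlMr ?powR_gt0// mul1r.
by apply: ge0_ler_powR; rewrite ?nnegrE// ltW.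
Qed.

(** * The dimension bound *)

Lemma limf_einf_at_right_ge (R : realType) (f : R -> \bar R) (m a : R) :
    (forall D : R, (0 < D < 1)%R ->
      (m * ln D^-1 + a)%:E <= f D) ->
  m%:E <= limf_einf (fun D => f D / (ln D^-1)%:E) (0 : R)^'+.
Proof.
move=> hf; rewrite limf_einfE; apply/lee_subgt0Pr => e e0.
(* Below this threshold ln D^-1 > |a| / e, so a / ln D^-1 >= - e. *)
pose d := expR (- (`|a| / e)).
have d0 : (0 < d)%R by exact: expR_gt0.
have d1 : (d <= 1)%R.
  by rewrite -expR0 ler_expR oppr_le0 divr_ge0// ltW.
apply: le_ereal_sup_tmp.
exists (ereal_inf [set f D / (ln D^-1)%:E | D in `]0%R, d[%classic]).
  exists (`]0%R, d[%classic) => //=.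
  near=> D; rewrite /= in_itv/=; apply/andP; split; near: D.
    exact: nbhs_right_gt.
  exact: nbhs_right_lt.
apply: le_ereal_inf_tmp => _ [D /= + <-]; rewrite in_itv/= => /andP[D0 Dd].
have D1 : (0 < D < 1)%R by rewrite D0 (lt_le_trans Dd).
have lD : (`|a| / e < ln D^-1)%R.
  by rewrite lnV ?posrE// ltrNr -ltr_expR lnK ?posrE.
have lD0 : (0 < ln D^-1)%R by apply: le_lt_trans lD; rewrite divr_ge0// ltW.
rewrite inver gt_eqF// lee_pdivlMr// (le_trans _ (hf D D1))//.
rewrite -EFinB -EFinM lee_fin mulrBl lerD2l lerNl.
rewrite ltr_pdivrMr// mulrC in lD.
by rewrite (le_trans _ (ltW lD))// -normrN ler_norm.
Unshelve. all: by end_near. Qed.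

Theorem corollary3p1 (R : realType) (d d1 d2 : measure_display)
    (Omega : measurableType d) (P : probability Omega R)
    (calX : measurableType d1) (calY : measurableType d2)
    (msingX : forall x : calX, measurable [set x])
    (msingY : forall y : calY, measurable [set y])
    (mu : {sigma_finite_measure set calX -> \bar R})
    (X : {RV P >-> calX})
    (X_mu : distribution P X `<< mu)
    (entropy_fin : `|gen_entropy mu X| < +oo)
    (rho : calX * calY -> \bar R) (rho_dist : is_distortion rho)
    (k m c : R) (delta0 : \bar R)
    (k_gt0 : (0 < k)%R) (m_gt0 : (0 < m)%R)
    (mu_subreg : subregular (fun z => poweR (rho z) k^-1) mu m c delta0)
    (mu1 : delta0 < +oo -> mu [set: calX] = 1) :
  m%:E <= lower_rd_dim X rho k.
Proof.
have [b b0 hb] := subregular_preimage_le rho_dist k_gt0 mu_subreg mu1.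
have p0 : (0 < m / k)%R by rewrite divr_gt0.
pose C := (b * (2 * expR 1 * (m / k) `^ (m / k)))%R.
have C0 : (0 < C)%R by rewrite !mulr_gt0// ?expR_gt0 ?powR_gt0.
have hfin : gen_entropy mu X \is a fin_num by rewrite fin_num_abs.
apply: (@limf_einf_at_right_ge _ _ _ (fine (gen_entropy mu X) - 2 - ln C)).
move=> D /andP[D0 _]; apply: le_ereal_inf_tmp => _ [K /= hK <-].
(* 2 s is the tilting parameter: it turns the distortion budget D^k into 2. *)
pose s := ((D `^ k)^-1)%R.
have Dk0 : (0 < D `^ k)%R by exact: powR_gt0.
have s0 : (0 < s)%R by rewrite invr_gt0.
have g0 : (0 < C * D `^ m)%R by rewrite mulr_gt0// powR_gt0.
have mrho y : measurable_fun [set: calX] (fun x => rho (x, y)).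
  exact: measurableT_comp rho_dist.1 _.
apply: le_trans (shannon_lower_bound X_mu entropy_fin rho_dist
  (s := (2 * s)%R) (g := (C * D `^ m)%R) _ g0 _ hK); last 2 first.
- by rewrite mulr_ge0// ltW.
- move=> y.
  have := integral_exp_le (mrho y) (fun x => rho_dist.2 (x, y)) b0 p0 s0 (hb y).
  by rewrite /s invrK -powRrM [(k * _)%R]mulrCA divff ?gt_eqF// mulr1.
rewrite -mulrA mulVf ?gt_eqF// mulr1 -[in leRHS](fineK hfin).
rewrite lnM ?posrE ?powR_gt0// ln_powR lnV ?posrE//.
rewrite -!EFinB lee_fin; lra.
Qed.
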